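(* Let $(X,d)$ be a compact metric space, $(X,f_{1,\infty})$ a nonautonomous dynamical system, and $K$ a nonempty subset of $X$. If the sequence $f_{1,\infty}$ is equicontinuous, then for any $k\in\mathbb{N}$, $$D(f_{1,\infty}^k,K)=D(f_{1,\infty},K).$$
   Context: $\mathbb{N}=\{1,2,\dots\}$. A nonautonomous dynamical system $(X,f_{1,\infty})$ consists of a compact space $X$ and a sequence $f_{1,\infty}=(f_i)_{i\ge 1}$ of continuous maps $f_i:X\to X$. Put $f_i^0=\mathrm{id}_X$ and $f_i^j=f_{i+j-1}\circ\cdots\circ f_{i+1}\circ f_i$. For $k\in\mathbb{N}$, $f_{1,\infty}^k$ denotes the sequence of maps $(f_1^k,f_{k+1}^k,f_{2k+1}^k,\dots)$. The sequence $f_{1,\infty}$ is equicontinuous if for any $\varepsilon>0$ there is $\delta>0$ such that $d(f_i(x),f_i(y))<\varepsilon$ for all $i\ge1$ whenever $d(x,y)<\delta$. Pesin topological entropy dimension of a sequence $g_{1,\infty}=(g_i)_{i\ge1}$ of continuous selfmaps of $X$ on nonempty $K\subseteq X$ (applied above to $g_{1,\infty}=f_{1,\infty}$ and $f_{1,\infty}^k$). Put $g_1^0=\mathrm{id}_X$, $g_1^j=g_j\circ\cdots\circ g_1$. For a finite open cover $\mathcal{U}$ of $X$, let $S(\mathcal{U})$ be the set of all finite strings $\mathbf{U}=(U_{i_0},\dots,U_{i_{m-1}})$ of elements of $\mathcal{U}$, with length $m(\mathbf{U})=m$, and let $X(\mathbf{U})=\{x\in X: g_1^j(x)\in U_{i_j},\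 0\le j\le m(\mathbf{U})-1\}$. A collection $\mathcal{G}\subseteq S(\mathcal{U})$ covers $K$ if $K\subseteq\bigcup_{\mathbf{U}\in\mathcal{G}}X(\mathbf{U})$. For $\alpha\in\mathbb{R}$, $s>0$ let $M(g_{1,\infty},K,s,\mathcal{U},\alpha,N)=\inf_{\mathcal{G}}\sum_{\mathbf{U}\in\mathcal{G}}e^{-\alpha m(\mathbf{U})^s}$, the infimum over all finite or countable $\mathcal{G}\subseteq S(\mathcal{U})$ covering $K$ with $m(\mathbf{U})\ge N$ for all $\mathbf{U}\in\mathcal{G}$. Let $m(g_{1,\infty},K,s,\mathcal{U},\alpha)=\lim_{N\to\infty}M(g_{1,\infty},K,s,\mathcal{U},\alpha,N)$, $D(g_{1,\infty},K,s,\mathcal{U})=\inf\{\alpha: m(g_{1,\infty},K,s,\mathcal{U},\alpha)=0\}=\sup\{\alpha: m(g_{1,\infty},K,s,\mathcal{U},\alpha)=\infty\}$, and $D(g_{1,\infty},K,s)=\sup_{\mathcal{U}}D(g_{1,\infty},K,s,\mathcal{U})$ over finite open covers $\mathcal{U}$ of $X$. Then $D(g_{1,\infty},K)=\sup\{s>0:D(g_{1,\infty},K,s)=+\infty\}=\inf\{s>0:D(g_{1,\infty},K,s)=0\}$, with $\inf\emptyset=+\infty$ and $\sup\emptyset=0$ for sets of $s>0$. *)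

(* Defs.v *)
From mathcomp Require Import all_boot all_order all_algebra.
From mathcomp Require Import all_classical all_reals all_analysis.

Set Implicit Arguments.
Unset Strict Implicit.
Unset Printing Implicit Defensive.

Import Order.TTheory GRing.Theory Num.Theory.
Import numFieldNormedType.Exports.

Local Open Scope classical_set_scope.
Local Open Scope ring_scope.

(* A sequence of selfmaps is indexed from 0: [f n] is the map written f_{n+1}
   in the literature, where the indices start at 1. *)

(* f_{i+1}^j = f_{i+j} \o ... \o f_{i+2} \o f_{i+1} *)
Fixpoint ncomp (X : Type) (f : nat -> X -> X) (i j : nat) : X -> X :=
  if j is j'.+1 then f (i + j')%N \o ncomp f i j' else id.

(* f_{1,oo}^k = (f_1^k, f_{k+1}^k, f_{2k+1}^k, ...) *)
Definition niter (X : Type) (f : nat -> X -> X) (k : nat) : nat -> X -> X :=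
  fun n => ncomp f (n * k) k.

(* The library's [equicontinuous] is the pointwise notion, where the modulus
   may depend on the base point. *)
Definition equicontinuous_seq (R : realType) (X : metricType R)
    (f : nat -> X -> X) : Prop :=
  forall e : R, 0 < e -> exists2 d : R, 0 < d &
    forall (n : nat) (x y : X), mdist x y < d -> mdist (f n x) (f n y) < e.

Definition finite_open_cover (X : topologicalType) (U : set (set X)) : Prop :=
  [/\ finite_set U, (forall A, U A -> open A) & \bigcup_(A in U) A = [set: X]].

Section EntropyDimension.
Context {R : realType} {X : topologicalType}.
Implicit Types (g : nat -> X -> X) (K : set X) (s a : R) (U : set (set X)).

Definition strings U : set (seq (set X)) :=
  [set u | forall A, A \in u -> U A].

Definition string_set g (u : seq (set X)) : set X :=
  [set x | forall j, (j < size u)%N -> nth set0 u j (ncomp g 0 j x)].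

Definition admissible g K U (N : nat) (G : set (seq (set X))) : Prop :=
  [/\ countable G, G `<=` strings U,
      K `<=` \bigcup_(u in G) string_set g u &
      forall u, G u -> (N <= size u)%N].

Definition pesin_M g K s U a (N : nat) : \bar R :=
  ereal_inf
    [set \esum_(u in G) (expR (- a * (size u)%:R `^ s))%:E
       | G in [set G | admissible g K U N G]].

Definition pesin_m g K s U a : \bar R := limn (pesin_M g K s U a).

Definition pesin_D_cover g K s U : \bar R :=
  ereal_inf [set a%:E | a in [set a : R | pesin_m g K s U a = 0%E]].

Definition pesin_D_at g K s : \bar R :=
  ereal_sup [set pesin_D_cover g K s U
               | U in [set U | finite_open_cover U]].

(* [ereal_sup set0] is -oo, whereas here the supremum of an empty set of
   positive s is 0, hence the [maxe]. *)
Definition pesin_D g K : \bar R :=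
  maxe 0%E (ereal_sup
    [set s%:E | s in [set s : R | 0 < s /\ pesin_D_at g K s = +oo%E]]).

Lemma pesin_M_nondecreasing g K s U a :
  {homo pesin_M g K s U a : n m / (n <= m)%N >-> (n <= m)%E}.
Proof.
move=> n m nm; apply: ereal_inf_le_tmp => _ [G [cG sG KG hG] <-].
by exists G => //; split => // u /hG; exact: leq_trans.
Qed.

Lemma pesin_mE g K s U a :
  pesin_m g K s U a = ereal_sup (range (pesin_M g K s U a)).
Proof.
apply: cvg_lim => //; apply: ereal_nondecreasing_cvgn.
exact: pesin_M_nondecreasing.
Qed.

Lemma pesin_M_ge0 g K s U a N : (0 <= pesin_M g K s U a N)%E.
Proof.
apply: le_ereal_inf_tmp => _ [G _ <-].
by apply: esum_ge0 => u _; rewrite lee_fin expR_ge0.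
Qed.

Lemma pesin_m_ge0 g K s U a : (0 <= pesin_m g K s U a)%E.
Proof.
rewrite pesin_mE; apply: le_ereal_sup_tmp; exists (pesin_M g K s U a 0).
  by exists 0%N.
exact: pesin_M_ge0.
Qed.

Lemma pesin_m_jump g K s s' U a b :
  (forall A : R, \forall n \near \oo, A <= b * n%:R `^ s' - a * n%:R `^ s) ->
  (pesin_m g K s U a < +oo)%E -> pesin_m g K s' U b = 0%E.
Proof.
move=> hab may; apply/eqP; rewrite eq_le pesin_m_ge0 andbT pesin_mE.
apply: ge_ereal_sup => _ [N _ <-].
have mfin : pesin_m g K s U a \is a fin_num.
  by rewrite ge0_fin_numE// pesin_m_ge0.
have [c c0 mc] : exists2 c : R, 0 <= c & pesin_m g K s U a = c%:E.
  exists (fine (pesin_m g K s U a)); last by rewrite fineK.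
  by rewrite fine_ge0// pesin_m_ge0.
have c10 : 0 < c + 1 by rewrite ltr_wpDl.
apply/lee_addgt0Pr => e e0; rewrite add0e.
have ec0 : 0 < e / (c + 1) by rewrite divr_gt0.
have [N0 _ hN0] := hab (- ln (e / (c + 1))).
pose n := maxn N N0.
apply: (@le_trans _ _ (pesin_M g K s' U b n)).
  by apply: pesin_M_nondecreasing; rewrite leq_maxl.
have : (pesin_M g K s U a n < (c + 1)%:E)%E.
  apply: (@le_lt_trans _ _ c%:E); last by rewrite lte_fin ltrDl.
  by rewrite -mc pesin_mE; apply: ereal_sup_ubound; exists n.
move=> /ereal_inf_lt[_ [G [cG sG KG hG] <-]] Gc.
apply: ge_ereal_inf; exists (\esum_(u in G) (expR (- b * (size u)%:R `^ s'))%:E).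
  by exists G.
apply: ge_ereal_sup => _ [A [finA AG] <-].
apply: (@le_trans _ _ ((e / (c + 1))%:E *
    \sum_(u \in A) (expR (- a * (size u)%:R `^ s))%:E)%E).
  rewrite ge0_mule_fsumr; last by move=> u; rewrite lee_fin expR_ge0.
  apply: lee_fsum => // u /AG Gu; rewrite -EFinM lee_fin.
  rewrite -[e / (c + 1)]lnK ?posrE// -expRD ler_expR.
  have /hN0 : (N0 <= size u)%N.
    by apply: leq_trans (hG _ Gu); rewrite leq_maxr.
  rewrite lerBrDr addrC -lerBrDr opprK !mulNr => h.
  by rewrite lerNl opprD opprK addrC -lerBrDr opprK.
have -> : e%:E = ((e / (c + 1))%:E * (c + 1)%:E)%E.
  by rewrite -EFinM divfK// gt_eqF.
apply: lee_wpmul2l; first by rewrite lee_fin ltW.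
apply: (le_trans _ (ltW Gc)); apply: ereal_sup_ubound; exists A => //.
Qed.

Lemma near_infty_powR (s c : R) : 0 < s -> \forall n \near \oo, c <= n%:R `^ s.
Proof.
move=> s0; near=> n.
have [c0|c0] := leP c 0; first by rewrite (le_trans c0)// powR_ge0.
have -> : c = (c `^ s^-1) `^ s.
  by rewrite -powRrM mulVf ?gt_eqF// powRr1// ltW.
apply: ge0_ler_powR; rewrite ?nnegrE ?powR_ge0 ?ler0n// ?ltW//.
by near: n; exact: nbhs_infty_gtr.
Unshelve. all: by end_near. Qed.

Lemma pesin_m_jump_alpha g K s U a b : 0 < s -> a < b ->
  (pesin_m g K s U a < +oo)%E -> pesin_m g K s U b = 0%E.
Proof.
move=> s0 ab; apply: pesin_m_jump => A.
near=> n; rewrite -mulrBl mulrC -ler_pdivrMr ?subr_gt0//.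
by near: n; exact: near_infty_powR.
Unshelve. all: by end_near. Qed.

Lemma pesin_m_jump_s g K s s' U a b : 0 < s -> s < s' -> 0 < b ->
  (pesin_m g K s U a < +oo)%E -> pesin_m g K s' U b = 0%E.
Proof.
move=> s0 ss' b0; apply: pesin_m_jump => A.
near=> n.
have n1 : 1 <= n%:R `^ s :> R by near: n; exact: near_infty_powR.
have : (`|A| + a) / b <= n%:R `^ (s' - s).
  by near: n; apply: near_infty_powR; rewrite subr_gt0.
rewrite ler_pdivrMr// => h.
have -> : n%:R `^ s' = n%:R `^ (s' - s) * n%:R `^ s :> R.
  rewrite -powRD ?subrK//; apply/implyP => _.
  rewrite pnatr_eq0 -lt0n; near: n; exact: nbhs_infty_gt.
rewrite mulrA -mulrBl.
have hA : `|A| <= b * n%:R `^ (s' - s) - a by rewrite lerBrDr mulrC.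
apply: (le_trans (ler_norm A)); apply: (le_trans hA).
by rewrite ler_peMr// (le_trans _ hA).
Unshelve. all: by end_near. Qed.

Let ereal_inf_le_gap (Q : set R) (M : \bar R) :
  (forall x y : R, x < y -> (M < x%:E)%E -> Q y) ->
  (ereal_inf [set x%:E | x in Q] <= M)%E.
Proof.
move=> MQ; case: M MQ => [r| |] MQ; last 2 first.
- exact: leey.
- have h y : (ereal_inf [set x%:E | x in Q] <= y%:E)%E.
    apply: ereal_inf_lbound; exists y => //.
    by apply: (MQ (y - 1)); rewrite ?ltNyr// ltrBlDr ltrDl.
  case: (ereal_inf _) h => [i h|/(_ 0)//|//].
  by have := h (i - 1); rewrite lee_fin lerBrDr gerDl ler10.
- apply/lee_addgt0Pr => e e0; apply: ereal_inf_lbound.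
  exists (r + e) => //; apply: (MQ (r + e / 2)).
    by rewrite ltrD2l gtr_pMr// invf_lt1 ?ltr1n.
  by rewrite lte_fin ltrDl divr_gt0.
Qed.

(* The two expressions of the critical value of alpha agree. *)
Lemma pesin_D_coverE g K s U : 0 < s ->
  pesin_D_cover g K s U =
  ereal_sup [set a%:E | a in [set a : R | pesin_m g K s U a = +oo%E]].
Proof.
move=> s0; apply/eqP; rewrite eq_le; apply/andP; split.
  apply: ereal_inf_le_gap => x y xy supx; apply: (pesin_m_jump_alpha s0 xy).
  rewrite ltey; apply/eqP => mx; move: supx; rewrite ltNge => /negP; apply.
  by apply: ereal_sup_ubound; exists x.
apply: ge_ereal_sup => _ [a ma <-]; apply: le_ereal_inf_tmp => _ [b mb <-].
rewrite lee_fin leNgt; apply/negP => ba.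
have := pesin_m_jump_alpha (g := g) (K := K) (U := U) s0 ba.
by rewrite mb ltry => /(_ isT); rewrite ma.
Qed.

Lemma pesin_D_cover_ge0 g K s U : 0 < s -> K !=set0 ->
  (0 <= pesin_D_cover g K s U)%E.
Proof.
move=> s0 [x Kx]; apply: le_ereal_inf_tmp => _ [b mb <-].
rewrite lee_fin leNgt; apply/negP => b0.
have := pesin_m_jump_alpha (g := g) (K := K) (U := U) s0 b0.
rewrite mb ltry => /(_ isT)/eqP; apply/negP; rewrite gt_eqF//.
apply: (@lt_le_trans _ _ 1%E); first exact: lte01.
rewrite pesin_mE; apply: le_ereal_sup_tmp; exists (pesin_M g K s U 0 0).
  by exists 0%N.
apply: le_ereal_inf_tmp => _ [G [cG sG KG hG] <-].
have [u Gu _] := KG _ Kx.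
apply: esum_ge; exists [set u].
  by split; [exact: finite_set1|move=> _ ->].
by rewrite fsbig_set1 oppr0 mul0r expR0.
Qed.

Lemma pesin_D_at_ge0 g K s : 0 < s -> K !=set0 -> (0 <= pesin_D_at g K s)%E.
Proof.
move=> s0 K0; apply: le_ereal_sup_tmp.
exists (pesin_D_cover g K s [set [set: X]]); last exact: pesin_D_cover_ge0.
exists [set [set: X]] => //; split; first exact: finite_set1.
  by move=> _ ->; exact: openT.
by rewrite bigcup_set1.
Qed.

Lemma pesin_D_at_jump g K s s' : 0 < s -> s < s' -> K !=set0 ->
  (pesin_D_at g K s < +oo)%E -> pesin_D_at g K s' = 0%E.
Proof.
move=> s0 ss' K0 Dy; apply/eqP; rewrite eq_le pesin_D_at_ge0 ?(lt_trans s0)//.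
rewrite andbT; apply: ge_ereal_sup => _ [U Uc <-].
have : (pesin_D_cover g K s U < +oo)%E.
  by apply: le_lt_trans Dy; apply: ereal_sup_ubound; exists U.
move=> /ereal_inf_lt[_ [a ma <-] _].
apply/lee_addgt0Pr => e e0; rewrite add0e; apply: ereal_inf_lbound.
exists e; last by [].
apply: (@pesin_m_jump_s g K s s' U a e s0 ss' e0); by rewrite ma ltry.
Qed.

(* The two expressions of the critical value of s agree. *)
Lemma pesin_DE g K : K !=set0 ->
  pesin_D g K = ereal_inf
    [set s%:E | s in [set s : R | 0 < s /\ pesin_D_at g K s = 0%E]].
Proof.
move=> K0; apply/eqP; rewrite eq_le; apply/andP; split.
  apply: le_ereal_inf_tmp => _ [t [t0 Dt] <-].
  rewrite ge_max lee_fin (ltW t0)/=; apply: ge_ereal_sup => _ [s [s0 Ds] <-].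
  rewrite lee_fin leNgt; apply/negP => ts.
  have := pesin_D_at_jump (g := g) t0 ts K0.
  by rewrite Dt ltry => /(_ isT); rewrite Ds.
apply: ereal_inf_le_gap => x y xy; rewrite gt_max lte_fin => /andP[x0 supx].
split; first exact: lt_trans xy.
apply: (pesin_D_at_jump x0 xy K0).
rewrite ltey; apply/eqP => Dx; move: supx; rewrite ltNge => /negP; apply.
by apply: ereal_sup_ubound; exists x.
Qed.

End EntropyDimension.

(* Main.v *)
Require Import Defs.
From HB Require Import structures.
From mathcomp Require Import all_boot all_order all_algebra finmap.
From mathcomp Require Import all_classical all_reals all_analysis.
Import Order.TTheory GRing.Theory Num.Theory.
Import numFieldNormedType.Exports.
Local Open Scope classical_set_scope.
Local Open Scope ring_scope.

(** Time [n] for the [k]-th iterate is time [n k] for [f], so strings over an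
open cover can be converted between the two systems at the price of
multiplying their lengths by [k] or by [1/k].

From [f] to its iterate, keep every [k]-th letter of a string: this forgets
constraints and divides the length by [k] ([simulates_niter]).  From the
iterate to [f], the [k - 1] skipped letters must be recovered.  Given a cover
[U] with Lebesgue number [e], equicontinuity gives a [d], independent of the
time, such that the compositions of fewer than [k] consecutive maps send balls
of radius [d] into balls of radius [e], hence into members of [U].  If [V] is
a cover by subsets of balls of radius [d], then each letter of a [V]-string of the
iterate determines [k] consecutive letters in [U] ([simulates_blocks]).

In both cases one string is sent to one string, with no branching, so a cover
of [K] by strings of one system yields a cover of [K] by no more strings of
the other.  Since [exp (- b (c m)^s) = exp (- (b c^s) m^s)], scaling the
lengths by [c] scales the critical exponent [D(., K, s, .)] by [c^(-s)]
([simulates_pesin_m_le]).  This factor affects neither the finiteness of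
[D(., K, s)] nor, consequently, the critical [s] ([simulates_pesin_D_le]);
the two conversions give the two inequalities. *)

(** * Sums over images *)

(** Only one preimage of each point of the image is counted on the left. *)
Lemma le_esum_image {R : realType} {T T' : choiceType} (P : set T)
    (e : T -> T') (a : T' -> \bar R) : (forall y, 0 <= a y)%E ->
  (\esum_(y in e @` P) a y <= \esum_(x in P) a (e x))%E.
Proof.
move=> a0; have [->|/set0P[x0 Px0]] := eqVneq P set0.
  by rewrite image_set0 !esum_set0.
have /choice[s sP] y : exists x, (e @` P) y -> P x /\ e x = y.
  have [[x Px exy]|nPy] := pselect ((e @` P) y); first by exists x.
  by exists x0.
have es : {in e @` P, cancel s e} by move=> y /set_mem /sP[].
(* [s] is a section of [e], so the left sum runs over the subset
   [s @` (e @` P)] of [P]. *)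
have -> : \esum_(y in e @` P) a y = \esum_(y in e @` P) a (e (s y)).
  by apply: eq_esum => y /mem_set /es ->.
rewrite -(esum_image _ s (a \o e)); last exact: can_in_inj es.
apply: ereal_sup_le => _ [A [finA AQ] <-]; exists A => //; split=> //.
by move=> x /AQ[y /sP[Psy _] <-].
Qed.

(** * Converting strings of one system into strings of another *)

(** Only a lower bound on the new length is required, because lengthening a
string decreases its weight; the inclusion makes converted covers cover. *)
Definition simulates {R : realType} {X : topologicalType} (c : R)
    (g : nat -> X -> X) (U : set (set X)) (h : nat -> X -> X)
    (V : set (set X)) : Prop :=
  forall u, strings U u -> exists v,
    [/\ strings V v, string_set g u `<=` string_set h v &
        c * (size u)%:R <= (size v)%:R].

Section Simulation.
Context {R : realType} {X : topologicalType}.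
Implicit Types (g h : nat -> X -> X) (K : set X) (U V : set (set X)).
Implicit Types (s b c : R).

(** Converting the strings of a cover of [K] does not add strings, and a string
of length at least [c m] weighs at most [exp (- (b c^s) m^s)].  The sign of [b]
matters, since longer strings weigh less only for [0 <= b]. *)
Lemma simulates_pesin_m_le {c s b g h K U V} : 0 < c -> 0 <= s -> 0 <= b ->
  simulates c g U h V ->
  (pesin_m h K s V b <= pesin_m g K s U (b * c `^ s))%E.
Proof.
move=> c0 s0 b0 gh.
have /choice[phi phiP] u : exists v, strings U u ->
    [/\ strings V v, string_set g u `<=` string_set h v &
        c * (size u)%:R <= (size v)%:R].
  have [/gh[v ?]|nUu] := pselect (strings U u); first by exists v.
  by exists [::].
rewrite pesin_mE; apply: ge_ereal_sup => _ [N _ <-].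
(* A string of length at least [N'] is converted into one of length at
   least [c N' >= N]. *)
pose N' := (Num.truncn (c^-1 * N%:R)).+1.
apply: (@le_trans _ _ (pesin_M g K s U (b * c `^ s) N')); last first.
  by rewrite pesin_mE; apply: ereal_sup_ubound; exists N'.
apply: le_ereal_inf_tmp => _ [G [cG sG KG hG] <-].
apply: ge_ereal_inf.
exists (\esum_(v in phi @` G) (expR (- b * (size v)%:R `^ s))%:E).
  exists (phi @` G) => //; split.
  - exact: sub_countable (card_image_le _ _) cG.
  - by move=> _ [u /sG/phiP[? _ _] <-].
  - move=> x /KG[u Gu xu]; exists (phi u); first by exists u.
    by have [_ + _] := phiP u (sG u Gu); apply.
  - move=> _ [u Gu <-]; have [_ _ cu] := phiP u (sG u Gu).
    rewrite -(ler_nat R); apply: le_trans cu; rewrite -ler_pdivrMl//.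
    apply: le_trans (ltW (truncnS_gt _)) _.
    by rewrite ler_nat; exact: hG.
apply: le_trans (le_esum_image _ _ _ _) _.
  by move=> v; rewrite lee_fin expR_ge0.
apply: le_esum => u /sG/phiP[_ _ cu].
rewrite lee_fin ler_expR !mulNr lerN2 -mulrA ler_wpM2l//.
rewrite -powRM ?ler0n ?(ltW c0)// ge0_ler_powR ?nnegrE ?ler0n//.
by rewrite mulr_ge0 ?ler0n ?(ltW c0).
Qed.

(** The constant [c] does not depend on the cover [V], so the bound
[D(h, K, s, V) <= c^(-s) D(g, K, s, U)] is uniform in [V]. *)
Lemma simulates_pesin_D_at_lty {c s g h K} : 0 < c -> 0 < s ->
  (forall V, finite_open_cover V ->
     exists2 U, finite_open_cover U & simulates c g U h V) ->
  (pesin_D_at g K s < +oo)%E -> (pesin_D_at h K s < +oo)%E.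
Proof.
move=> c0 s0 gh Dg.
have [B B0 DB] : exists2 B : R, 0 < B & (pesin_D_at g K s < B%:E)%E.
  case: (pesin_D_at g K s) Dg => [r _|//|_]; last by exists 1; rewrite ?ltNyr.
  exists (Num.max 0 r + 1); first by rewrite ltr_wpDl// le_max lexx.
  by rewrite lte_fin ltr_pwDr// le_max lexx orbT.
have cs0 : 0 < c `^ s by rewrite powR_gt0.
apply: (@le_lt_trans _ _ (B / c `^ s)%:E); last exact: ltry.
apply: ge_ereal_sup => _ [V /gh[U Uc UV] <-].
apply: ereal_inf_lbound; exists (B / c `^ s) => //=.
apply/eqP; rewrite eq_le pesin_m_ge0 andbT.
apply: le_trans (simulates_pesin_m_le c0 (ltW s0) _ UV) _.
  by rewrite divr_ge0 ?ltW.
rewrite divfK ?gt_eqF//.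
have : (pesin_D_cover g K s U < B%:E)%E.
  by apply: le_lt_trans DB; apply: ereal_sup_ubound; exists U.
move=> /ereal_inf_lt[_ [a ma <-] aB].
by rewrite (pesin_m_jump_alpha (a := a))// ma ltry.
Qed.

Lemma simulates_pesin_D_le {c g h K} : 0 < c ->
  (forall V, finite_open_cover V ->
     exists2 U, finite_open_cover U & simulates c g U h V) ->
  (pesin_D (R := R) h K <= pesin_D g K)%E.
Proof.
move=> c0 gh; rewrite ge_max; apply/andP; split; first by rewrite le_max lexx.
rewrite le_max; apply/orP; right; apply: ereal_sup_le.
move=> _ [s [s0 hs] <-]; exists s => //; split => //.
apply/eqP; rewrite -leye_eq leNgt; apply/negP.
by move=> /(simulates_pesin_D_at_lty c0 s0 gh); rewrite hs.
Qed.

End Simulation.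

(** * Strings of a sequence of maps and of its iterate *)

Lemma ncompD {X : Type} (f : nat -> X -> X) i j l x :
  ncomp f i (j + l) x = ncomp f (i + j) l (ncomp f i j x).
Proof. by elim: l => [|l IH]; rewrite ?addn0// addnS/= IH addnA. Qed.

Lemma ncomp_niter {X : Type} (f : nat -> X -> X) k i x :
  ncomp (niter f k) 0 i x = ncomp f 0 (i * k) x.
Proof. by elim: i => [//|i IH]; rewrite mulSnr ncompD/= IH. Qed.

Lemma strings_mkseq {X : topologicalType} (U : set (set X)) (F : nat -> set X)
    n :
  (forall i, (i < n)%N -> U (F i)) -> strings U (mkseq F n).
Proof. by move=> UF A /mapP[i]; rewrite mem_iota => /UF + ->. Qed.

Lemma strings_nth {X : topologicalType} (U : set (set X)) u i :
  strings U u -> (i < size u)%N -> U (nth set0 u i).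
Proof. by move=> Uu iu; apply: Uu; rewrite mem_nth. Qed.

(** The points of [string_set f u] visit the [i k]-th letter of [u] at time
[i] of the iterate. *)
Lemma simulates_niter {R : realType} {X : topologicalType} (f : nat -> X -> X)
    (U : set (set X)) k : (0 < k)%N ->
  simulates (R := R) k%:R^-1 f U (niter f k) U.
Proof.
move=> k0 u Uu.
(* The multiples of [k] below [size u] number the ceiling of [size u / k]. *)
pose n := ((size u + k.-1) %/ k)%N.
have lt_n i : (i < n)%N -> (i * k < size u)%N.
  by move=> ilt; rewrite -(ltn_add2r k.-1) -addnS prednK// -mulSnr -leq_divRL.
exists (mkseq (fun i => nth set0 u (i * k)) n); split.
- by apply: strings_mkseq => i /lt_n; exact: strings_nth.
- move=> x xu i; rewrite size_mkseq => ilt; rewrite nth_mkseq// ncomp_niter.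
  exact/xu/lt_n.
- rewrite size_mkseq mulrC ler_pdivrMr ?ltr0n// -natrM ler_nat.
  rewrite -(leq_add2r k.-1) -ltnS -[X in (_ < X)%N]addnS prednK// -mulSnr.
  exact: ltn_ceil.
Qed.

(** A letter [A] of a [V]-string of the iterate, read at time [q], confines
the orbit under [f] to a member of [U] at each of the times
[q k, ..., q k + k - 1]. *)
Lemma simulates_blocks {R : realType} {X : topologicalType}
    (f : nat -> X -> X) (U V : set (set X)) k : (0 < k)%N ->
  (forall n j A, (j < k)%N -> V A ->
     exists2 B, U B & forall x, A x -> B (ncomp f n j x)) ->
  simulates (R := R) k%:R (niter f k) V f U.
Proof.
move=> k0 VU v Vv.
(* The letter at time [i] of [f] is determined by the block [i %/ k] that
   contains [i] and by the position [i %% k] in this block. *)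
have /choice[F FP] i : exists B, (i < size v * k)%N -> U B /\
    forall x, nth set0 v (i %/ k) x -> B (ncomp f (i %/ k * k) (i %% k) x).
  have [ilt|_] := boolP (i < size v * k)%N; last by exists set0.
  have qv : (i %/ k < size v)%N by rewrite ltn_divLR.
  have [B UB AB] :=
    VU (i %/ k * k)%N _ _ (ltn_pmod i k0) (strings_nth _ _ _ Vv qv).
  by exists B.
exists (mkseq F (size v * k)); split.
- by apply: strings_mkseq => i /FP[].
- move=> x xv i; rewrite size_mkseq => ilt; rewrite nth_mkseq//.
  rewrite {2}(divn_eq i k) ncompD add0n -ncomp_niter.
  by have [_ +] := FP i ilt; apply; apply: xv; rewrite ltn_divLR.
- by rewrite size_mkseq mulnC natrM.
Qed.

(** * Covers adapted to blocks of maps *)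

(** Composing [k] moduli of continuity gives one modulus for all the blocks of
length at most [k], whatever their starting time. *)
Lemma equicontinuous_ncomp {R : realType} {X : metricType R}
    (f : nat -> X -> X) (k : nat) (e : R) :
  equicontinuous_seq f -> 0 < e ->
  exists2 d : R, 0 < d & forall n j x y, (j <= k)%N ->
    mdist x y < d -> mdist (ncomp f n j x) (ncomp f n j y) < e.
Proof.
move=> ef; elim: k e => [|k IH] e e0.
  by exists e => // n j x y; rewrite leqn0 => /eqP ->.
have [d1 d10 fd1] := ef _ e0.
have [d d0 fd] := IH (Num.min d1 e) ltac:(by rewrite lt_min d10).
exists d => // n j x y; rewrite leq_eqVlt => /orP[/eqP ->|jk] xyd.
  by apply: fd1; have := fd n k x y (leqnn k) xyd; rewrite lt_min => /andP[].
by have := fd n j x y jk xyd; rewrite lt_min => /andP[].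
Qed.

(** At each point a small radius works for all nearby centers; compactness, in
the form of [near_covering], then provides a radius that works everywhere. *)
Lemma lebesgue_number {R : realType} {X : pseudoMetricType R}
    (U : set (set X)) : compact [set: X] -> (forall A, U A -> open A) ->
  \bigcup_(A in U) A = [set: X] ->
  exists2 e : R, 0 < e & forall x, exists2 A, U A & ball x e `<=` A.
Proof.
move=> /compact_near_coveringP cX oU UX.
have : \forall e \near 0^'+,
    [set: X] `<=` (fun x => exists2 A, U A & ball x (e : R) `<=` A).
  apply: cX => x _; have [A UA Ax] : (\bigcup_(A in U) A) x by rewrite UX.
  have /nbhs_ballP[r /= r0 rA] : nbhs x A.
    by apply: open_nbhs_nbhs; split => //; exact: oU.
  have r20 : 0 < r / 2 by rewrite divr_gt0.
  exists (ball x (r / 2), [set e | e <= r / 2]) => /=.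
    by split; [exact: nbhsx_ballx|exact: nbhs_right_le].
  move=> [y e] /= [xy er]; exists A => // z yz; apply: rA.
  by rewrite [r]splitr; apply: ball_triangle xy _; exact: le_ball yz.
move=> nearU.
have [e [/= e0 eU]] := filter_ex (filterI (nbhs_right_gt 0) nearU).
by exists e => // x; exact: eU.
Qed.

Lemma finite_open_cover_balls {R : realType} {X : pseudoMetricType R} (d : R) :
  compact [set: X] -> [set: X] !=set0 -> 0 < d ->
  exists2 V : set (set X), finite_open_cover V &
    forall A, V A -> exists x, A `<=` ball x d.
Proof.
move=> cX [x0 _] d0.
(* [compact_cover] is stated for pointed spaces; the space is nonempty here,
   and the choice of the point does not change its topology. *)
pose pX := HB.pack_for ptopologicalType X (isPointed.Build X x0).
have : @compact pX [set: X] := cX.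
rewrite compact_cover => /(_ X setT (fun x => (ball x d)^°))[||D _ XD].
- by move=> x _; exact: open_interior.
- by move=> x _; exists x => //; exact: nbhsx_ballx.
exists ((fun x => (ball x d)^°) @` [set` D]).
  split.
  - exact/finite_image/finite_fset.
  - by move=> _ [x _ <-]; exact: open_interior.
  - by rewrite bigcup_image; apply/seteqP; split.
by move=> _ [x _ <-]; exists x; exact: interior_subset.
Qed.

(** * Invariance of the entropy dimension under iteration *)

Theorem theorem3p17 (R : realType) (X : metricType R) (f : nat -> X -> X)
    (K : set X) (k : nat)
    (hX : compact [set: X]) (hf : forall n : nat, continuous (f n))
    (hK : K !=set0) (hequi : equicontinuous_seq f) (hk : (0 < k)%N) :
  pesin_D (R := R) (niter f k) K = pesin_D (R := R) f K.
Proof.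
have k0 : 0 < k%:R :> R by rewrite ltr0n.
apply/eqP; rewrite eq_le; apply/andP; split.
  apply: (@simulates_pesin_D_le _ _ k%:R^-1); first by rewrite invr_gt0.
  by move=> U Uc; exists U => //; exact: simulates_niter.
apply: (@simulates_pesin_D_le _ _ k%:R) => // U [_ oU UX].
(* [e] is a Lebesgue number of [U], and balls of radius [d] stay within [e]
   along any block. *)
have [e e0 eU] := lebesgue_number U hX oU UX.
have [d d0 fd] := equicontinuous_ncomp f k e hequi e0.
have [x Kx] := hK.
have [V Vc Vd] := finite_open_cover_balls d hX (ex_intro _ x I) d0.
exists V => //; apply: simulates_blocks => // n j A jk /Vd[y Ay].
have [B UB yB] := eU (ncomp f n j y); exists B => // z /Ay yz.
by apply: yB; move: yz; rewrite !ballEmdist; exact/fd/ltnW.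
Qed.
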